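(* Let $(\mu,\sigma,r) \in \mathbb{R} \times \mathbb{R}^+ \times (1,\infty)$ (with $\sigma > 0$) and suppose $X \sim \mathrm{GLN}(\mu,\sigma,r)$ with density $f_r$. (1) The function $$h_r(x) = \begin{cases} \sin\{(x-1)^{1/4}\} \exp\left\{ \frac{1}{r\sigma^r} |\ln x - \mu|^r + \ln x - (x-1)^{1/4} \right\}, & x > 1, \\ 0, & x \le 1, \end{cases}$$ is bounded on $\mathbb{R}^+$, for all $(\mu,\sigma,r) \in \mathbb{R} \times \mathbb{R}^+ \times (1,\infty)$, and satisfies $\mathbb{E}[X^k h_r(X)] = 0$ for all $k = 0,1,2,\dots$. (2) The function $p_r := h_r / H_r$, with $H_r := \sup_x |h_r(x)|$, defines a perturbation corresponding to $f_r$; that is, $-1 \le p_r(x) \le 1$ for all $x$ and $\mathbb{E}[X^k p_r(X)] = 0$ for all $k = 0,1,2,\dots$. (3) The family of functions $f_{r,\varepsilon}(x) = f_r(x)[1 + \varepsilon\, p_r(x)]$, $\varepsilon \in [-1,1]$, defines a Stieltjes class comprising distributions whose moments are identical to those of $f_r$ for any $\varepsilon \in [-1,1]$; that is, for every $\varepsilon \in [-1,1]$, $f_{r,\varepsilon}$ is a probability density on $(0,\infty)$ with $\int_0^\infty x^k f_{r,\varepsilon}(x)\,dx = \int_0^\infty x^k f_r(x)\,dx$ for all $k = 0,1,2,\dots$.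
   Context: For $\mu \in \mathbb{R}$, $\sigma > 0$, $r > 0$, the generalized lognormal distribution $\mathrm{GLN}(\mu,\sigma,r)$ is the probability distribution on $(0,\infty)$ with density $$f_r(x) = \frac{1}{2\, x\, r^{1/r}\, \sigma\, \Gamma(1+1/r)} \exp\left\{ -\frac{1}{r\,\sigma^r} |\ln x - \mu|^r \right\}, \quad 0 < x < \infty.$$ Given a moment-indeterminate distribution with density $f$ (i.e. a distribution with finite moments of all orders that is not uniquely determined by its moment sequence), with $X$ a random variable with density $f$, a Stieltjes class corresponding to $f$ is a set $$\mathcal{S}(f,p) = \{ f_\varepsilon(x) \mid f_\varepsilon(x) := f(x)[1 + \varepsilon\, p(x)],\ x \in \operatorname{supp}(f),\ \varepsilon \in [-1,1] \},$$ where $p$ is a perturbation function, i.e. a function satisfying $-1 \le p(x) \le 1$ and $\mathbb{E}[X^k p(X)] = 0$ for all $k = 0,1,2,\dots$. Generalized lognormal distributions with $1 < r < \infty$ have finite moments of all orders and are moment-indeterminate. *)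

(* Defs.v *)
From HB Require Import structures.
From mathcomp Require Import all_boot all_order all_algebra.
From mathcomp Require Import all_classical all_reals all_analysis.

Set Implicit Arguments.
Unset Strict Implicit.
Unset Printing Implicit Defensive.

Import Order.TTheory GRing.Theory Num.Theory.
Import numFieldNormedType.Exports.

Local Open Scope classical_set_scope.
Local Open Scope ring_scope.

Definition Gamma {R : realType} (a : R) : R :=
  (\int[lebesgue_measure]_(t in `]0, +oo[) (t `^ (a - 1) * expR (- t)))%R.

(* The density of GLN(mu, sigma, r), extended by 0 outside ]0, +oo[. *)
Definition gln_pdf {R : realType} (mu sigma r x : R) : R :=
  if 0 < x then
    (2 * x * r `^ r^-1 * sigma * Gamma (1 + r^-1))^-1 *
    expR (- ((r * sigma `^ r)^-1 * `|ln x - mu| `^ r))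
  else 0.

Definition gln_h {R : realType} (mu sigma r x : R) : R :=
  if 1 < x then
    sin ((x - 1) `^ 4^-1) *
    expR ((r * sigma `^ r)^-1 * `|ln x - mu| `^ r + ln x - (x - 1) `^ 4^-1)
  else 0.

Definition gln_H {R : realType} (mu sigma r : R) : R :=
  sup [set `|gln_h mu sigma r x| | x in `]0, +oo[].

Definition gln_p {R : realType} (mu sigma r x : R) : R :=
  gln_h mu sigma r x / gln_H mu sigma r.

Definition is_pdf_pos {R : realType} (f : R -> R) : Prop :=
  [/\ measurable_fun [set: R] f,
      forall x, 0 < x -> 0 <= f x,
      forall x, x <= 0 -> f x = 0 &
      (\int[lebesgue_measure]_(x in `]0%R, +oo[) (f x)%:E = 1)%E].

Definition pdf_moment {R : realType} (f : R -> R) (k : nat) : \bar R :=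
  (\int[lebesgue_measure]_(x in `]0%R, +oo[) (x ^+ k * f x)%:E)%E.

Definition has_density {d : measure_display} {T : measurableType d}
    {R : realType} {P : probability T R} (X : {RV P >-> R}) (f : R -> R) : Prop :=
  forall A : set R, measurable A ->
    (distribution P X A = \int[lebesgue_measure]_(x in A) (f x)%:E)%E.

Definition finite_moments {R : realType}
    (Q : probability R R) : Prop :=
  forall k : nat, Q.-integrable [set: R] (fun x : R => (x ^+ k)%:E).

Definition moment_indeterminate {R : realType}
    (Q : probability R R) : Prop :=
  finite_moments Q /\
  exists Q' : probability R R,
    [/\ finite_moments Q',
        forall k : nat,
          (\int[Q']_x (x ^+ k)%:E = \int[Q]_x (x ^+ k)%:E)%E &
        exists2 A : set R, measurable A & Q' A <> Q A].

(* Integrability is required because the integral underlying 'E_P[_] is total: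
   without it, the equation alone would not say that the expectation exists. *)
Definition zero_weighted_moments {d : measure_display} {T : measurableType d}
    {R : realType} {P : probability T R} (X : {RV P >-> R}) (q : R -> R) : Prop :=
  forall k : nat,
    P.-integrable [set: T] (fun w => (X w ^+ k * q (X w))%:E) /\
    ('E_P[(fun w => X w ^+ k * q (X w))%R] = 0)%E.

Definition is_perturbation {d : measure_display} {T : measurableType d}
    {R : realType} {P : probability T R} (X : {RV P >-> R}) (p : R -> R) : Prop :=
  (forall x, -1 <= p x <= 1) /\ zero_weighted_moments X p.

Definition perturbed {R : realType} (f p : R -> R) (eps x : R) : R :=
  f x * (1 + eps * p x).

(* S = S(f, p) where f is the density of X.  Members of S are functions on all
   of R; since f vanishes off its support, so do they. *)
Definition is_stieltjes_class {d : measure_display} {T : measurableType d}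
    {R : realType} {P : probability T R} (X : {RV P >-> R})
    (f p : R -> R) (S : set (R -> R)) : Prop :=
  [/\ has_density X f,
      moment_indeterminate (distribution P X),
      is_perturbation X p &
      S = [set perturbed f p eps | eps in `[-1, 1]]].

(* Main.v *)
(** With [v = (x - 1)^(1/4)] one has [x^k h(x) f(x) = N x^k sin v e^-v] for
    [x > 1]; substituting [x = 1 + v^4], the moment of order [k] of [h] is [N]
    times the integral over [v > 0] of [4 v^3 (1 + v^4)^k sin v e^-v], a
    combination of the integrals of [v^(4 n + 3) sin v e^-v], that is, of the
    imaginary parts of [(4 n + 3)! / (1 - i)^(4 n + 4)], which vanish because
    [(1 - i)^4 = -4].  Here this is realised by an explicit antiderivative
    vanishing at both ends.  Everything else follows from growth comparison: in
    the variable [ln x], [v] is exponential, [|ln x - mu|^r] is superlinear and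
    subexponential.  Moment indeterminacy of [f] is witnessed by [f (1 + p)]. *)

Require Import Defs.
From HB Require Import structures.
From mathcomp Require Import all_boot all_order all_algebra.
From mathcomp Require Import all_classical all_reals all_analysis.
From mathcomp Require Import measurable_realfun ring lra.

Set Implicit Arguments.
Unset Strict Implicit.
Unset Printing Implicit Defensive.

Import Order.TTheory GRing.Theory Num.Theory.
Import numFieldNormedType.Exports.

Local Open Scope classical_set_scope.
Local Open Scope ring_scope.

(** Nested square roots, unlike the power [4^-1], are continuous on all of [R], as [Num.sqrt] is 0
    on negative numbers; hence [wave] is continuous across 1. *)
Local Notation root4 x := (Num.sqrt (Num.sqrt x)).
Local Notation wave R k :=
  (fun x : R => x ^+ k * (expR (- root4 (x - 1)) * sin (root4 (x - 1)))).

(** * Growth comparisons in the variable [ln x] *)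

Section bounds.
Context {R : realType}.
Implicit Types (a c mu r t x z : R).

Lemma exprn_le_expR n z : 0 <= z -> z ^+ n <= n`!%:R * expR z.
Proof.
case: n => [|n] z0; first by rewrite expr0 mul1r -expR0 ler_expR.
rewrite -ler_pdivrMl ?ltr0n ?fact_gt0// mulrC.
by apply: le_trans (expR_ge1Dxn n z0); rewrite lerDr.
Qed.

(** Superlinear growth wins because [r > 1]. At [t = ln x] this bounds a power of [x] times the
    exponential factor of the density. *)
Lemma linear_sub_powR_bounded a c mu r : 0 < c -> 1 < r ->
  exists K, forall t, a * t - c * `|t - mu| `^ r <= K.
Proof.
move=> c0 r1; have r1_gt0 : 0 < r - 1 by lra.
(* [y0] solves [c y^(r - 1) = |a|]: beyond it [c y^r] dominates [|a| y], and below it [|a| y] is at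
   most [|a| y0]. *)
pose b := `|a| / c; pose y0 := b `^ (r - 1)^-1.
have b0 : 0 <= b by rewrite divr_ge0// ltW.
exists (`|a| * y0 + `|a| * `|mu|) => t.
set y := `|t - mu|; have y_ge0 : 0 <= y by exact: normr_ge0.
have ty : a * t <= `|a| * y + `|a| * `|mu|.
  rewrite (le_trans (ler_norm _))// normrM -mulrDr ler_wpM2l//.
  by rewrite -{1}(subrK mu t) ler_normD.
suff : `|a| * y - c * y `^ r <= `|a| * y0 by lra.
have [yy0|y0y] := leP y y0.
  have : `|a| * y <= `|a| * y0 by rewrite ler_wpM2l.
  have : 0 <= c * y `^ r by rewrite mulr_ge0 ?powR_ge0// ltW.
  lra.
suff : `|a| * y <= c * y `^ r.
  have : 0 <= `|a| * y0 by rewrite mulr_ge0// powR_ge0.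
  lra.
rewrite -(mulr_powRB1 y_ge0) ?(lt_trans _ r1)// mulrCA [leRHS]mulrC.
rewrite [leLHS]mulrC [leRHS]mulrC ler_wpM2l// -ler_pdivrMl// mulrC -/b.
have -> : b = y0 `^ (r - 1) by rewrite -powRrM mulVf ?gt_eqF// powRr1.
by rewrite ge0_ler_powR ?nnegrE ?powR_ge0// ltW.
Qed.

(** This is the exponent in [h]. With [w = ln (1 + v)], the two positive terms are bounded by a
    polynomial in [w], while [v = e^w - 1] is exponential in [w]. *)
Lemma powR_ln_sub_root4_bounded c mu r : 0 < c -> 0 < r ->
  exists K, forall x, 1 <= x ->
    c * `|ln x - mu| `^ r + ln x - (x - 1) `^ 4^-1 <= K.
Proof.
move=> c0 r0; pose N := Num.truncn r.
have rN : r <= N.+1%:R by rewrite ltW// truncnS_gt.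
pose M := `|mu| + 1; have M1 : 1 <= M by rewrite lerDr.
(* [B] is chosen so that [z^n <= n! e^z], taken at [z / 4 = w + M / 4] with [n = N + 3], reads
   [B z^(N + 3) <= 1 + v]. *)
pose B := expR (- (M / 4)) / (4 ^+ N.+3 * N.+3`!%:R).
have B0 : 0 < B by rewrite divr_gt0 ?expR_gt0// mulr_gt0 ?ltr0n ?fact_gt0.
(* The first summand bounds [(c + 1) z^(N + 2) - B z^(N + 3)], which is nonpositive once
   [z >= (c + 1) / B]; the final 1 pays for replacing [v] by [1 + v]. *)
exists ((c + 1) * ((c + 1) / B) ^+ N.+2 + 1) => x x1.
set v := (x - 1) `^ 4^-1; have v0 : 0 <= v by exact: powR_ge0.
have v4 : v ^+ 4 = x - 1.
  by rewrite -powR_mulrn// -powRrM mulVf// powRr1// subr_ge0.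
pose w := ln (1 + v); have w0 : 0 <= w by rewrite ln_ge0// lerDl.
have ew : expR w = 1 + v by rewrite lnK// posrE ltr_wpDr.
have lnx0 : 0 <= ln x by exact: ln_ge0.
have lnx : ln x <= 4 * w.
  rewrite mulr_natl -lnXn; last by rewrite ltr_wpDr.
  rewrite ler_ln ?posrE ?exprn_gt0 ?ltr_wpDr//; last by lra.
  have -> : x = 1 + v ^+ 4 by rewrite v4; ring.
  have v2 : 0 <= v ^+ 2 by rewrite exprn_ge0.
  have v3 : 0 <= v ^+ 3 by rewrite exprn_ge0.
  have -> : (1 + v) ^+ 4 = 1 + v ^+ 4 + (4 * v + 6 * v ^+ 2 + 4 * v ^+ 3) by ring.
  by rewrite lerDl; lra.
pose z := 4 * w + M; have z1 : 1 <= z by rewrite /z; lra.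
have z0 : 0 <= z by lra.
have lnxz : ln x <= z ^+ N.+2.
  by rewrite (le_trans lnx)// (@le_trans _ _ z) ?ler_eXnr// /z; lra.
have normz : `|ln x - mu| <= z.
  rewrite (le_trans (ler_normB _ _))// ger0_norm// /z /M; lra.
have powz : `|ln x - mu| `^ r <= z ^+ N.+2.
  apply: (@le_trans _ _ (z `^ r)).
    by apply: ge0_ler_powR; rewrite ?nnegrE// ltW.
  apply: (@le_trans _ _ (z `^ N.+1%:R)); first by rewrite ler_powR.
  by rewrite powR_mulrn// ler_weXn2l.
have expz : B * z ^+ N.+3 <= 1 + v.
  have := exprn_le_expR N.+3 (divr_ge0 z0 (ler0n _ 4)).
  have -> : z / 4 = w + M / 4 by rewrite /z mulrDl [4 * w]mulrC mulfK.
  rewrite expRD ew => h.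
  have -> : B * z ^+ N.+3 = expR (- (M / 4)) * (N.+3`!%:R)^-1 * (z / 4) ^+ N.+3.
    rewrite /B expr_div_n invfM; ring.
  have -> : z / 4 = w + M / 4 by rewrite /z mulrDl [4 * w]mulrC mulfK.
  rewrite -mulrA expRN ler_pdivrMl ?expR_gt0// ler_pdivrMl ?ltr0n ?fact_gt0//.
  by rewrite [expR (M / 4) * _]mulrC.
have zb : (c + 1) * z ^+ N.+2 - B * z ^+ N.+3 <= (c + 1) * ((c + 1) / B) ^+ N.+2.
  have [zs|zl] := leP z ((c + 1) / B).
    rewrite (@le_trans _ _ ((c + 1) * z ^+ N.+2))//.
      by rewrite gerBl mulr_ge0 ?exprn_ge0// ltW.
    rewrite ler_wpM2l//; first lra.
    by apply: lerXn2r => //; rewrite nnegrE divr_ge0// ?ltW//; lra.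
  rewrite (@le_trans _ _ 0)//.
    rewrite [z ^+ N.+3]exprS mulrA -mulrBl mulr_le0_ge0 ?exprn_ge0// subr_le0.
    by rewrite mulrC -ler_pdivrMr// ltW.
  by rewrite mulr_ge0 ?exprn_ge0 ?divr_ge0// ?ltW//; lra.
have : c * `|ln x - mu| `^ r <= c * z ^+ N.+2 by rewrite ler_pM2l.
lra.
Qed.

End bounds.

(** * Integration against a measure given by a density *)

Section density.
Context d (T : measurableType d) (R : realType).
Variables (la : {sigma_finite_measure set T -> \bar R})
  (Q : {finite_measure set T -> \bar R}) (f : T -> R).
Hypotheses (f_ge0 : forall x, 0 <= f x) (mf : measurable_fun [set: T] f)
  (Qf : forall A, measurable A -> Q A = (\int[la]_(x in A) (f x)%:E)%E).

Let int_f : la.-integrable [set: T] (EFin \o f).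
Proof.
apply/integrableP; split; first exact/measurable_EFinP.
under eq_integral do rewrite /= ger0_norm//.
by rewrite -Qf// ltey_eq fin_num_measure.
Qed.

(** [Q] is absolutely continuous with respect to [la], and its Radon-Nikodym derivative agrees with
    [f] almost everywhere, having the same integral over every measurable set. *)
Lemma ge0_integral_density (g : T -> \bar R) :
  (forall x, 0 <= g x)%E -> measurable_fun [set: T] g ->
  (\int[Q]_x g x = \int[la]_x (g x * (f x)%:E))%E.
Proof.
move=> g0 mg.
have Qla : Q `<< la.
  apply/null_content_dominatesP => A mA laA0; rewrite Qf//.
  by apply: null_set_integral => //; apply: measurable_funTS; exact/measurable_EFinP.
rewrite -(Radon_Nikodym_SigmaFinite.change_of_variables Qla)//.
have mrn := measurable_int _ (Radon_Nikodym_SigmaFinite.f_integrable Qla).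
apply: ae_eq_integral => //.
- exact: emeasurable_funM.
- by apply: emeasurable_funM => //; exact/measurable_EFinP.
- apply: ae_eqe_mul2l; apply: integral_ae_eq => //.
  + exact: Radon_Nikodym_SigmaFinite.f_integrable.
  + exact/measurable_EFinP.
  + by move=> A _ mA; rewrite -Radon_Nikodym_SigmaFinite.f_integral// Qf.
Qed.

Lemma integrable_density (g : T -> R) : measurable_fun [set: T] g ->
  la.-integrable [set: T] (fun x => (g x * f x)%:E) ->
  Q.-integrable [set: T] (fun x => (g x)%:E).
Proof.
move=> mg /integrableP[_ gf]; apply/integrableP; split.
  exact/measurable_EFinP.
rewrite ge0_integral_density//; last first.
  by apply: measurableT_comp => //; exact/measurable_EFinP.
under eq_integral => x _.
  rewrite -[X in (_ * X)%E]gee0_abs ?lee_fin// -abseM -EFinM; over.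
by [].
Qed.

(** Multiplication by [f >= 0] commutes with taking positive and negative parts, so the nonnegative
    case applies to each. *)
Lemma integral_density (g : T -> R) : measurable_fun [set: T] g ->
  (\int[Q]_x (g x)%:E = \int[la]_x (g x * f x)%:E)%E.
Proof.
move=> mg; have mEg : measurable_fun [set: T] (fun x => (g x)%:E).
  exact/measurable_EFinP.
rewrite [LHS]integralE [RHS]integralE.
rewrite !ge0_integral_density//; [|exact: measurable_funeneg|exact: measurable_funepos].
congr (_ - _)%E; apply: eq_integral => x _.
- by rewrite !funeposE maxe_pMl ?lee_fin// mul0e EFinM.
- by rewrite !funenegE maxe_pMl ?lee_fin// mul0e EFinM mulNe.
Qed.

End density.

(** * Antiderivatives of a polynomial times [sin u e^-u] *)

Section oscillating_antiderivative.
Context {R : realType}.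
Implicit Types (p q : {poly R}) (u x : R).

Lemma cvg_poly_expRN p : p.[u] * expR (- u) @[u --> +oo] --> (0 : R).
Proof.
under eq_fun do rewrite horner_coef mulr_suml.
suff : \sum_(i < size p) p`_i * u ^+ i * expR (- u) @[u --> +oo] -->
    \sum_(i < size p) p`_i * (0 : R).
  by rewrite big1// => i _; rewrite mulr0.
apply: cvg_big => [|i _]; first exact: add_continuous.
under eq_fun do rewrite -mulrA; apply: cvgMr.
(* Bounding [u^(i + 1)], one power more than needed, by [(i + 1)! e^u] leaves a factor [1 / u]. *)
apply: (@squeeze_cvgr _ _ _ _ (cst 0) (fun u => i.+1`!%:R * u^-1)).
- near=> u; have u0 : 0 < u by near: u; exact: nbhs_pinfty_gt.
  rewrite /= mulr_ge0 ?exprn_ge0 ?expR_ge0 ?(ltW u0)//= expRN.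
  rewrite ler_pdivrMr ?expR_gt0// mulrAC ler_pdivlMr//.
  by rewrite -exprSr; apply: exprn_le_expR; rewrite ltW.
- exact: cvg_cst.
- rewrite -(mulr0 i.+1`!%:R); apply: cvgMr.
  apply/(gtr0_cvgV0 (f := id)); last exact: cvg_id.
  exact: nbhs_pinfty_gt.
Unshelve. all: by end_near. Qed.

(* Integrating [e^-u p(u) sin u] as [e^-u (A sin u + B cos u)] requires
   [A' - A - B = p] and [B' - B + A = 0], hence [(D^2 - 2 D + 2) B = - p]; the
   formula for [B] is [(D^2 - 2 D + 2) (1 + D + D^2 / 2) = 2 (1 + D^4 / 4)]. *)
Lemma is_derive_sin_expRN q u :
  let B := - 2^-1 *: (q + q^`() + 2^-1 *: q^`(2)) in let A := B - B^`() in
  is_derive u 1 (fun x => expR (- x) * (A.[x] * sin x + B.[x] * cos x))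
    (expR (- u) * sin u * (q + 4^-1 *: q^`(4)).[u]).
Proof.
move=> B A.
have dA := is_derive_poly A u; have dB := is_derive_poly B u.
apply: is_derive_eq.
rewrite /A derivB /B !derivnS derivn0 !(derivZ, derivD) !hornerE /GRing.scale /=.
by field.
Qed.

(** The operator [1 + D^4 / 4] preserves exponents modulo 4, so it can be inverted among the
    exponents congruent to 3. The solution then has no terms of degree 0, 1, 2, which makes the
    antiderivative vanish at 0. *)
Lemma exists_poly_add_derivn4 (c : nat -> R) n :
  exists q, q + 4^-1 *: q^`(4) = \sum_(i < n) c i *: 'X^(4 * i + 3) /\
    forall i, (i < 3)%N -> q`_i = 0.
Proof.
have monom m : exists q, q + 4^-1 *: q^`(4) = 'X^(4 * m + 3) /\
    forall i, (i < 3)%N -> q`_i = 0.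
  elim: m => [|m [q [qE q0]]].
    exists 'X^3; split; last by case=> [|[|[|]]]//; rewrite coefXn.
    by rewrite derivnXn ffact_small// mulr0n scaler0 addr0.
  pose a := 4^-1 * ((4 * m.+1 + 3) ^_ 4)%:R : R.
  (* Applied to [X^(4 m + 7)], the operator leaves the surplus [a X^(4 m + 3)], which is [a] times
     the image of the previous solution [q]. *)
  exists ('X^(4 * m.+1 + 3) - a *: q); split.
    have aX : 4^-1 *: ('X^(4 * m + 3) *+ (4 * m.+1 + 3) ^_ 4) =
        a *: 'X^(4 * m + 3) :> {poly R} by rewrite -[X in _ *: X = _]scaler_nat scalerA.
    rewrite derivnB derivnZ derivnXn scalerBr.
    have -> : (4 * m.+1 + 3 - 4 = 4 * m + 3)%N by rewrite mulnS -addnA addKn.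
    rewrite aX -qE scalerDr 2!scalerA [a / 4]mulrC.
    by rewrite addrK subrK.
  move=> i i3; rewrite coefB coefZ q0// mulr0 subr0 coefXn.
  by rewrite mulnS -addnA ltn_eqF// (leq_trans i3)// (leq_trans _ (leq_addr _ _)).
elim: n => [|n [q [qE q0]]].
  by exists 0; rewrite big_ord0 linear0 scaler0 addr0; split=> // i _; rewrite coef0.
have [qn [qnE qn0]] := monom n; exists (q + c n *: qn); split.
  rewrite derivnD derivnZ big_ord_recr/= -qE -qnE !scalerDr.
  by rewrite !scalerA [c n * _]mulrC addrACA.
by move=> i i3; rewrite coefD coefZ q0// qn0// mulr0 addr0.
Qed.

Lemma sin_expRN_antiderivative (c : nat -> R) n : exists G : R -> R,
  [/\ forall u, is_derive u 1 G
        (expR (- u) * sin u * \sum_(i < n) c i * u ^+ (4 * i + 3)),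
      G 0 = 0 & G u @[u --> +oo] --> 0].
Proof.
have [q [qE q0]] := exists_poly_add_derivn4 c n.
pose B := - 2^-1 *: (q + q^`() + 2^-1 *: q^`(2)); pose A := B - B^`().
exists (fun x => expR (- x) * (A.[x] * sin x + B.[x] * cos x)); split.
- move=> u; have := is_derive_sin_expRN q u; rewrite qE horner_sum.
  by under eq_bigr do rewrite hornerZ hornerXn.
(* Only [B.[0]] survives at 0, and it is [-1/2] times the sum of the coefficients of [q] of degree
   0, 1, 2. *)
- rewrite sin0 mulr0 add0r cos0 mulr1 horner_coef0 coefZ !coefD coefZ coef_deriv.
  by rewrite coef_derivn !q0// !(mul0rn, addr0, mulr0).
- apply/norm_cvg0P.
  apply: (@squeeze_cvgr _ _ _ _ (cst 0)
    (fun u => `|A.[u] * expR (- u)| + `|B.[u] * expR (- u)|)).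
  + near=> u; rewrite normr_ge0/= mulrDr.
    rewrite (le_trans (ler_normD _ _))// !mulrA ![expR _ * _]mulrC.
    by rewrite lerD// normrM ler_piMr// (sin_max, cos_max).
  + exact: cvg_cst.
  + by rewrite -(addr0 0); apply: cvgD; apply/norm_cvg0P; exact: cvg_poly_expRN.
Unshelve. all: by end_near. Qed.

End oscillating_antiderivative.

(** * Integrability and vanishing integral of the oscillating functions [wave] *)

Section root4_integrals.
Context {R : realType}.
Implicit Types (k : nat) (x : R).
Local Notation mu := (@lebesgue_measure R).

Lemma powR4V x : 0 <= x -> x `^ 4^-1 = root4 x.
Proof.
move=> x0; rewrite -(powR12_sqrt x0) -powR12_sqrt ?powR_ge0// -powRrM.
by congr (_ `^ _); field.
Qed.

(** Write the logarithm [k ln x - v] as [((k - 1) ln x - (ln x)^2) + ((ln x)^2 + ln x - v)]; the two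
    growth comparisons with exponent 2 bound the summands. *)
Lemma exprn_expRN_root4_bounded k :
  exists K, forall x, 1 <= x -> x ^+ k * expR (- root4 (x - 1)) <= K.
Proof.
have [K1 K1P] := linear_sub_powR_bounded (k%:R - 1) 0 (@ltr01 R) (@ltr1n R 2).
have [K2 K2P] := powR_ln_sub_root4_bounded 0 (@ltr01 R) (@ltr0n R 2).
exists (expR (K1 + K2)) => x x1; have x0 : 0 < x by exact: lt_le_trans x1.
rewrite -[x in x ^+ k]lnK// -expRM_natl -expRD ler_expR.
have := K2P _ x1; have := K1P (ln x); rewrite powR4V ?subr_ge0//; lra.
Qed.

Lemma continuous_invr_sqr x : x != 0 -> {for x, continuous (fun y : R => y ^- 2)}.
Proof.
by move=> x0; apply: continuousV; [rewrite sqrf_eq0|exact: exprn_continuous].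
Qed.

(** [x^-2] is the comparison function used below to dominate both [wave] and the tails of the
    moments of the density. *)
Lemma integral_invr_sqr :
  (\int[mu]_(x in `[1%R, +oo[) (x ^- 2)%:E = 1)%E.
Proof.
rewrite (@ge0_continuous_FTC2y _ _ (fun x => - x^-1) _ 0)//.
- by rewrite invr1 EFinN sub0e oppeK.
- by move=> x _; rewrite invr_ge0 sqr_ge0.
- apply: continuous_in_subspaceT => x; rewrite inE/= in_itv/= andbT => x1.
  by apply: continuous_invr_sqr; rewrite gt_eqF// (lt_le_trans ltr01).
- rewrite -oppr0; apply: cvgN; apply/(gtr0_cvgV0 (f := id)); last exact: cvg_id.
  exact: nbhs_pinfty_gt.
- move=> x x1; apply: derivableN; apply: derivableV => //.
  by rewrite gt_eqF// (lt_trans ltr01).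
- apply: cvg_at_right_filter; apply: cvgN; apply: cvgV; [by []|exact: cvg_id].
- move=> x; rewrite in_itv/= andbT => x1; rewrite derive1E.
  have x0 : x != 0 by rewrite gt_eqF// (lt_trans ltr01).
  rewrite deriveN ?deriveV ?derive_id//; last exact: derivableV.
  by rewrite scaleNr opprK /GRing.scale/= mulr1.
Qed.

Lemma integrable_invr_sqr :
  mu.-integrable `[1, +oo[ (fun x : R => (x ^- 2)%:E).
Proof.
apply/integrableP; split.
  apply/measurable_EFinP; apply: subspace_continuous_measurable_fun => //.
  apply: continuous_in_subspaceT => x; rewrite inE/= in_itv/= andbT => x1.
  by apply: continuous_invr_sqr; rewrite gt_eqF// (lt_le_trans ltr01).
under eq_integral => x _ do rewrite gee0_abs ?lee_fin ?invr_ge0 ?sqr_ge0//.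
by rewrite integral_invr_sqr ltry.
Qed.

Lemma continuous_root4B1 : continuous (fun x : R => root4 (x - 1)).
Proof.
move=> x; apply: (@continuous_comp _ _ _ (fun x : R => Num.sqrt (x - 1)) Num.sqrt).
  apply: (@continuous_comp _ _ _ (fun x : R => x - 1) Num.sqrt).
    by apply: continuousB; [exact: cvg_id|exact: cvg_cst].
  exact: sqrt_continuous.
exact: sqrt_continuous.
Qed.

Lemma cvgr_sqrty : Num.sqrt x @[x --> (+oo : set_system R)] --> +oo.
Proof.
apply/cvgryPge => A; near=> x; rewrite (le_trans (ler_norm A))//.
by rewrite -sqrtr_sqr ler_wsqrtr//; near: x; exact: nbhs_pinfty_ge.
Unshelve. all: by end_near. Qed.

Lemma continuous_wave k : continuous (wave R k).
Proof.
move=> x; apply: cvgM; first exact: exprn_continuous.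
apply: cvgM.
  apply: (@continuous_comp _ _ _ (fun x : R => - root4 (x - 1)) expR).
    by apply: cvgN; exact: continuous_root4B1.
  exact: continuous_expR.
apply: (@continuous_comp _ _ _ (fun x : R => root4 (x - 1)) sin).
  exact: continuous_root4B1.
exact: continuous_sin.
Qed.

Lemma wave_le_invr_sqr k :
  exists K, forall x, 1 <= x -> `|wave R k x| <= K * x ^- 2.
Proof.
have [K KP] := exprn_expRN_root4_bounded k.+2; exists K => x x1.
have x0 : 0 < x by exact: lt_le_trans x1.
rewrite ler_pdivlMr ?exprn_gt0//; apply: le_trans (KP _ x1).
have kx : 0 <= x ^+ k.+2 * expR (- root4 (x - 1)).
  by rewrite mulr_ge0 ?expR_ge0 ?exprn_ge0 ?(ltW x0).
rewrite -[X in _ * X]ger0_norm ?sqr_ge0// -normrM.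
rewrite [X in `|X|](_ : _ =
  x ^+ k.+2 * expR (- root4 (x - 1)) * sin (root4 (x - 1))).
  by rewrite normrM (ger0_norm kx) ler_piMr// sin_max.
by rewrite -[k.+2]addn2 exprD; ring.
Qed.

Lemma integrable_wave k : mu.-integrable `[1, +oo[ (EFin \o wave R k).
Proof.
have [K KP] := wave_le_invr_sqr k.
apply: (le_integrable _ _ _ (integrableZl _ K integrable_invr_sqr)) => //.
  apply/measurable_EFinP; apply: measurable_funTS.
  apply: continuous_measurable_fun; exact: continuous_wave.
move=> x; rewrite /= in_itv/= andbT => x1.
by rewrite lee_fin (le_trans (KP _ x1))// ler_norm.
Qed.

(** Compose the previous antiderivative with [v = root4 (x - 1)]. The factor [4 v^3] cancels
    [dv/dx = 1 / (4 v^3)], and the binomial coefficients expand [x^k = (1 + v^4)^k]. The chain rule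
    through the square roots is used only for [x > 1], hence the separate continuity at 1. *)
Lemma wave_antiderivative k : exists G : R -> R,
  [/\ forall x, 1 < x -> is_derive x 1 G (wave R k x),
      G 1 = 0, {for 1, continuous G} & G x @[x --> +oo] --> 0].
Proof.
have [G [dG G0 Gy]] := sin_expRN_antiderivative (fun i => 4 * 'C(k, i)%:R : R) k.+1.
have cG : continuous G.
  by move=> u; apply/differentiable_continuous/derivable1_diffP; exact: ex_derive.
exists (fun x => G (root4 (x - 1))); split.
- move=> x x1; have x0 : 0 < x - 1 by rewrite subr_gt0.
  have v0 : 0 < root4 (x - 1) by rewrite !sqrtr_gt0.
  have s0 : 0 < Num.sqrt (x - 1) by rewrite sqrtr_gt0.
  have d1 : is_derive x 1 (fun x : R => x - 1) 1 by apply: is_derive_eq; rewrite subr0.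
  have d2 := @is_derive1_comp _ Num.sqrt _ x _ _ (is_derive1_sqrt x0) d1.
  have d3 := @is_derive1_comp _ Num.sqrt _ x _ _ (is_derive1_sqrt s0) d2.
  have d4 := @is_derive1_comp _ G _ x _ _ (dG _) d3.
  apply: (is_derive_eq d4) => /=.
  set v := root4 (x - 1).
  have sE : Num.sqrt (x - 1) = v ^+ 2 by rewrite sqr_sqrtr// ltW.
  have xE : x = 1 + v ^+ 4 by rewrite (exprM v 2 2) -sE sqr_sqrtr ?ltW//; ring.
  have -> : \sum_(i < k.+1) 4 * 'C(k, i)%:R * v ^+ (4 * i + 3) = 4 * v ^+ 3 * x ^+ k.
    rewrite [X in X ^+ k]xE exprDn mulr_sumr; apply: eq_bigr => i _.
    by rewrite expr1n mul1r exprD exprM -mulr_natr; ring.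
  by rewrite sE; field; rewrite gt_eqF.
- by rewrite subrr !sqrtr0.
- apply: continuous_comp; last exact: cG.
  exact: (@continuous_root4B1 1).
- apply: cvg_comp Gy; apply: (cvg_comp _ _ _ cvgr_sqrty).
  by apply: (cvg_comp _ _ _ cvgr_sqrty); exact: cvg_addrr.
Qed.

(** The fundamental theorem on a half-line is applied to a nonnegative integrand: adding the
    majorant [K x^-2] makes [wave] nonnegative. The antiderivative [G - K / x] rises from [-K] to 0,
    so the sum integrates to [K], which is already the integral of the majorant. *)
Lemma integral_wave k : (\int[mu]_(x in `[1%R, +oo[) (wave R k x)%:E = 0)%E.
Proof.
have [G [dG G1 cG Gy]] := wave_antiderivative k.
have [K KP] := wave_le_invr_sqr k.
have iK : mu.-integrable `[1, +oo[ (fun x => (K%:E * (x ^- 2)%:E)%E).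
  by apply: integrableZl => //; exact: integrable_invr_sqr.
have intK : (\int[mu]_(x in `[1%R, +oo[) (K%:E * (x ^- 2)%:E) = K%:E)%E.
  by rewrite integralZl// ?integral_invr_sqr ?mule1//; exact: integrable_invr_sqr.
have : (\int[mu]_(x in `[1%R, +oo[) ((wave R k x)%:E + K%:E * (x ^- 2)%:E) = K%:E)%E.
  under eq_integral do rewrite -EFinM -EFinD.
  have d1V x : x != 0 -> is_derive x 1 (fun y : R => y^-1) (- x ^- 2).
    move=> x0; have := @is_deriveV _ id x 1 1 x0 (is_derive_id _ _).
    by rewrite /GRing.scale/= mulr1.
  have dF x : 1 < x ->
      is_derive x 1 (G - K *: (fun y : R => y^-1)) (wave R k x + K * x ^- 2).
    move=> x1; have x0 : x != 0 by rewrite gt_eqF// (lt_trans ltr01).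
    have := dG _ x1; have := d1V _ x0 => ? ?; apply: is_derive_eq.
    by rewrite scalerN opprK.
  rewrite (@ge0_continuous_FTC2y _ _ (G - K *: (fun y : R => y^-1)) _ 0).
  - by rewrite -EFinB !fctE G1 !sub0r invr1 /GRing.scale/= mulr1 opprK.
  - by move=> x /KP; rewrite ler_norml => /andP[+ _]; rewrite -subr_ge0 opprK.
  - apply: continuous_in_subspaceT => x; rewrite inE/= in_itv/= andbT => x1.
    apply: cvgD; first exact: continuous_wave.
    apply: cvgMr; apply: continuous_invr_sqr.
    by rewrite gt_eqF// (lt_le_trans ltr01).
  - rewrite -(subr0 0) -[X in _ --> _ - X](mulr0 K); apply: cvgB => //.
    apply: cvgMr; apply/(gtr0_cvgV0 (f := id)); last exact: cvg_id.
    exact: nbhs_pinfty_gt.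
  - by move=> x /dF[].
  - apply: cvg_at_right_filter; apply: cvgB; first exact: cG.
    by apply: cvgMr; apply: cvgV; [|exact: cvg_id].
  - by move=> x; rewrite in_itv/= andbT => /dF[_ <-]; rewrite derive1E.
rewrite integralD//; last exact: integrable_wave.
rewrite intK => /(congr1 (fun z => z - K%:E)%E).
by rewrite addeK// subee.
Qed.


End root4_integrals.

(** * Laws and random variables with a prescribed density *)

Lemma exists_density_probability d (T : measurableType d) (R : realType)
    (la : {measure set T -> \bar R}) (f : T -> R) :
  (forall x, 0 <= f x) -> measurable_fun [set: T] f ->
  (\int[la]_x (f x)%:E = 1)%E ->
  exists Q : probability T R,
    forall A, measurable A -> Q A = (\int[la]_(x in A) (f x)%:E)%E.
Proof.
move=> f0 mf f1; pose nu (A : set T) := (\int[la]_(x in A) (f x)%:E)%E.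
have nu0 : nu set0 = 0%E by rewrite /nu integral_set0.
have nu_ge0 A : (0 <= nu A)%E by apply: integral_ge0 => x _; rewrite lee_fin.
have nu_sa : semi_sigma_additive nu.
  move=> /= F mF tF mUF; rewrite /nu; apply: cvg_toP.
    apply: ereal_nondecreasing_is_cvgn => m n mn.
    by apply: lee_sum_nneg_natr => // k _ _; exact: nu_ge0.
  rewrite ge0_integral_bigcup//=.
  - by apply/measurable_funTS/measurable_EFinP.
  - by move=> x _; rewrite lee_fin.
pose H1 := isMeasure.Build _ _ _ nu nu0 nu_ge0 nu_sa.
pose nu_measure : {measure set T -> \bar R} := HB.pack nu H1.
pose H2 := @Measure_isProbability.Build _ _ R nu_measure f1.
by exists (HB.pack_for (probability T R) nu H1 H2).
Qed.

Section random_variable_density.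
Context d (T : measurableType d) (R : realType) (P : probability T R)
  (X : {RV P >-> R}) (f : R -> R).
Hypotheses (f_ge0 : forall x, 0 <= f x) (mf : measurable_fun [set: R] f)
  (Xf : has_density X f).
Local Notation la := (@lebesgue_measure R).

(* [R] and [measurableTypeR R], the domain of the Lebesgue measure, have the
   same measurable sets but distinct displays. *)
Let mX : measurable_fun [set: T] (X : T -> measurableTypeR R).
Proof. exact: (@measurable_funPT _ _ _ _ X). Qed.

Let X' : {RV P >-> measurableTypeR R} :=
  @mfun_Sub _ _ T (measurableTypeR R) _ (mem_set mX).

Let X'f (A : set (measurableTypeR R)) : measurable A ->
  distribution P X' A = (\int[la]_(x in A) (f x)%:E)%E.
Proof. by move=> mA; rewrite -(Xf mA). Qed.

Variable g : R -> R.
Hypotheses (mg : measurable_fun [set: R] g)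
  (ig : la.-integrable [set: R] (fun x => (g x * f x)%:E)).

Let iX' : (distribution P X').-integrable setT (fun x => (g x)%:E).
Proof. exact: (@integrable_density _ (measurableTypeR R) R _ _ _ f_ge0 mf X'f). Qed.

Lemma integrable_comp_density : P.-integrable [set: T] (fun w => (g (X w))%:E).
Proof.
move/integrableP : iX' => [mEg gy]; apply/integrableP; split.
  by apply/measurable_EFinP; exact: measurableT_comp.
rewrite ge0_integral_distribution// in gy.
exact: measurableT_comp.
Qed.

Lemma integral_comp_density :
  (\int[P]_w (g (X w))%:E = \int[la]_x (g x * f x)%:E)%E.
Proof.
rewrite -(@integral_density _ (measurableTypeR R) R _ _ _ f_ge0 mf X'f)//.
rewrite integral_distribution//; last exact: integrable_comp_density.
exact/measurable_EFinP.
Qed.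

Lemma integrable_distribution_density :
  (distribution P X).-integrable [set: R] (fun x => (g x)%:E).
Proof.
apply: integrable_pushforward => //; last exact: integrable_comp_density.
exact/measurable_EFinP.
Qed.

Lemma integral_distribution_density :
  (\int[distribution P X]_x (g x)%:E = \int[la]_x (g x * f x)%:E)%E.
Proof.
rewrite integral_distribution ?integral_comp_density//.
  exact/measurable_EFinP.
exact: integrable_comp_density.
Qed.

End random_variable_density.

(** * The generalized lognormal density and the functions [h] and [p] *)

Section gln.
Context {R : realType} (mu sigma r : R).
Hypotheses (sigma_gt0 : 0 < sigma) (r_gt1 : 1 < r).
Implicit Types (k : nat) (x eps : R).

Local Notation f := (gln_pdf mu sigma r).
Local Notation h := (gln_h mu sigma r).
Local Notation H := (gln_H mu sigma r).
Local Notation p := (gln_p mu sigma r).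
Local Notation la := (@lebesgue_measure R).

Let c := (r * sigma `^ r)^-1.
(** The normalising factor with [1 / x] split off. Its sign comes from that of the integrand of
    [Gamma]; its strict positivity is deduced later from total mass 1. *)
Let N := (2 * r `^ r^-1 * sigma * Gamma (1 + r^-1))^-1.

Let r_gt0 : 0 < r. Proof. exact: lt_trans r_gt1. Qed.

Let c_gt0 : 0 < c.
Proof. by rewrite invr_gt0 mulr_gt0// powR_gt0. Qed.

Let N_ge0 : 0 <= N.
Proof.
rewrite invr_ge0 !mulr_ge0 ?powR_ge0 ?(ltW sigma_gt0)//.
apply: Rintegral_ge0 => t _.
by rewrite mulr_ge0 ?powR_ge0 ?expR_ge0.
Qed.

Let gln_pdfE x : 0 < x -> f x = N / x * expR (- (c * `|ln x - mu| `^ r)).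
Proof.
move=> x0; rewrite /gln_pdf x0 /N /c; congr (_ * _).
by rewrite -invfM; congr (_^-1); ring.
Qed.

Lemma gln_pdf0 x : x <= 0 -> f x = 0.
Proof. by rewrite leNgt /gln_pdf => /negbTE ->. Qed.

Lemma gln_pdf_ge0 x : 0 <= f x.
Proof.
have [/gln_pdf0 ->//|x0] := leP x 0.
by rewrite gln_pdfE// mulr_ge0 ?expR_ge0// divr_ge0// ltW.
Qed.

(** The factor [e^(ln x)] of [h] cancels the [1 / x] of [f], and the exponentials of
    [c |ln x - mu|^r] cancel each other. *)
Lemma gln_pdf_mulh x : f x * h x = N * (wave R 0%N \_ `[1%R, +oo[) x.
Proof.
rewrite patchE /gln_h; case: ltP => x1.
  have x0 : 0 < x by exact: lt_trans x1.
  rewrite mem_set/= ?in_itv/= ?andbT ?ltW// expr0 mul1r gln_pdfE// -/c.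
  rewrite powR4V ?subr_ge0 ?ltW// !expRD !expRN lnK//.
  field.
  by rewrite !gt_eqF ?expR_gt0.
(* The closed interval contains 1, where [h] is 0 by its case split; [wave] agrees there because
   [sin 0 = 0]. *)
rewrite mulr0; case: ifPn; last by rewrite mulr0.
rewrite inE/= in_itv/= andbT => x1'.
have -> : x = 1 by apply: le_anti; rewrite x1 x1'.
by rewrite subrr !sqrtr0 sin0 !mulr0.
Qed.

Let measurable_exponent :
  measurable_fun [set: R] (fun x => c * `|ln x - mu| `^ r).
Proof.
apply: measurable_funM => //.
apply: (measurableT_comp (measurable_powR r)); apply: measurableT_comp => //.
by apply: measurable_funB => //; exact: measurable_ln.
Qed.

Lemma measurable_gln_pdf : measurable_fun [set: R] f.
Proof.
(* Moving [1 / x] into the exponent as [- ln x] reduces measurability to that of [ln]. *)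
rewrite [f](_ : _ = fun x => if 0 < x then
    N * expR (- (c * `|ln x - mu| `^ r) - ln x) else 0); last first.
  apply/funext => x; case: ifPn => [x0|]; last by rewrite -leNgt => /gln_pdf0.
  by rewrite gln_pdfE// expRD [expR (- ln x)]expRN lnK// -mulrA [_^-1 * _]mulrC.
apply: measurable_fun_ifT => //; first exact: measurable_fun_ltr.
apply: measurable_funM => //; apply: measurableT_comp => //.
apply: measurable_funB; last exact: measurable_ln.
exact: measurableT_comp.
Qed.

Lemma measurable_gln_h : measurable_fun [set: R] h.
Proof.
have mroot : measurable_fun [set: R] (fun x : R => (x - 1) `^ 4^-1).
  by apply: (measurableT_comp (measurable_powR _)); exact: measurable_funB.
apply: measurable_fun_ifT => //; first exact: measurable_fun_ltr.
apply: measurable_funM.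
  apply: measurableT_comp mroot.
  exact: continuous_measurable_fun (@continuous_sin R).
apply: measurableT_comp => //; apply: measurable_funB => //.
by apply: measurable_funD => //; exact: measurable_ln.
Qed.

Lemma gln_h_bounded : exists M, forall x, `|h x| <= M.
Proof.
have [K KP] := powR_ln_sub_root4_bounded mu c_gt0 r_gt0.
exists (expR K) => x; rewrite /gln_h; case: ltP => x1; last by rewrite normr0 expR_ge0.
rewrite normrM -[leRHS]mul1r ler_pM// ?sin_max//.
by rewrite gtr0_norm ?expR_gt0// ler_expR KP// ltW.
Qed.

Lemma gln_h_le_H x : `|h x| <= H.
Proof.
have [M MP] := gln_h_bounded.
have sup_h : has_sup [set `|h x| | x in `]0, +oo[].
  split; first by exists `|h 1|, 1 => //=; rewrite in_itv/= ltr01.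
  by exists M => _ [y _ <-].
(* The supremum [H] ranges over positive arguments; elsewhere [h] is 0 and [0 <= |h 1| <= H]. *)
suff pos y : 0 < y -> `|h y| <= H.
  have [/pos//|x0] := ltP 0 x.
  rewrite [h x](_ : _ = 0); last by rewrite /gln_h ltNge (le_trans x0).
  by rewrite normr0 (le_trans (normr_ge0 _) (pos 1 ltr01)).
move=> y0; apply: sup_upper_bound => //.
by exists y => //=; rewrite in_itv/= y0.
Qed.

(** Here [0 < v <= 1], where the sine is positive. One point of this interval gives [H > 0]; the
    whole interval later separates the law of [f] from its perturbation. *)
Lemma gln_h_gt0 x : 1 < x < 2 -> 0 < h x.
Proof.
move=> /andP[x1 x2].
have x_le1 : (x - 1) `^ 4^-1 <= 1 `^ 4^-1.
  by apply: ge0_ler_powR; rewrite ?nnegrE ?invr_ge0//; lra.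
rewrite powR1 in x_le1; rewrite /gln_h x1 mulr_gt0 ?expR_gt0// sin2_gt0//.
by rewrite powR_gt0 ?subr_gt0//= (le_lt_trans x_le1)// ltr1n.
Qed.

Lemma gln_H_gt0 : 0 < H.
Proof.
apply: lt_le_trans (gln_h_le_H (3 / 2)).
by rewrite normr_gt0 gt_eqF// gln_h_gt0//; lra.
Qed.

Lemma gln_pE : p = (fun x => H^-1 * h x).
Proof. by apply/funext => x; rewrite /gln_p mulrC. Qed.

Lemma gln_p_itv x : -1 <= p x <= 1.
Proof.
rewrite -ler_norml /gln_p normrM normfV [X in _ / X]gtr0_norm ?gln_H_gt0//.
by rewrite ler_pdivrMr ?gln_H_gt0// mul1r gln_h_le_H.
Qed.

Let integral_exprn_gln_h k : la.-integrable [set: R]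
  (fun x => (x ^+ k * h x * f x)%:E) /\
  (\int[la]_x (x ^+ k * h x * f x)%:E = 0)%E.
Proof.
have fhE : (fun x => (x ^+ k * h x * f x)%:E) =
    (fun x => N%:E * ((EFin \o wave R k) \_ `[1%R, +oo[) x)%E.
  apply/funext => x; rewrite -mulrA [h x * _]mulrC gln_pdf_mulh !patchE.
  case: ifPn => _; rewrite /= ?mulr0 ?mule0// -EFinM.
  by congr (_%:E); rewrite expr0; ring.
have iw : la.-integrable [set: R] ((EFin \o wave R k) \_ `[1%R, +oo[).
  by rewrite -integrable_mkcond//; exact: integrable_wave.
split; rewrite fhE; first exact: integrableZl.
by rewrite integralZl// -integral_mkcond integral_wave mule0.
Qed.

(** * Moments of the density and of its perturbations; moment indeterminacy *)

Section finite_mass.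
Hypothesis int_f : (\int[la]_x (f x)%:E = 1)%E.

Let integrable_f : la.-integrable [set: R] (EFin \o f).
Proof.
apply/integrableP; split; first by apply/measurable_EFinP; exact: measurable_gln_pdf.
under eq_integral do rewrite /= ger0_norm ?gln_pdf_ge0//.
by rewrite int_f ltry.
Qed.

Lemma integrable_exprn_gln_pdf k :
  la.-integrable [set: R] (fun x => (x ^+ k * f x)%:E).
Proof.
(* For [0 < x < 1], [f] itself dominates [x^k f]. For [x >= 1], taking out [x^-2] turns the power
   [x^(k - 1)] of [x^k f] into [x^(k + 1)], hence the slope [k + 1]. *)
have [K KP] := linear_sub_powR_bounded k.+1%:R mu c_gt0 r_gt1.
pose g := (fun x => (f x)%:E + (N * expR K)%:E *
  ((fun x : R => (x ^- 2)%:E) \_ `[1%R, +oo[) x)%E.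
have ig : la.-integrable [set: R] g.
  apply: integrableD => //; apply: integrableZl => //.
  by rewrite -integrable_mkcond//; exact: integrable_invr_sqr.
apply: (le_integrable _ _ _ ig) => //.
  apply/measurable_EFinP; apply: measurable_funM; first exact: measurable_funX.
  exact: measurable_gln_pdf.
move=> x _; have [x0|x0] := leP x 0.
  by rewrite gln_pdf0// mulr0 abse0.
have f0 := gln_pdf_ge0 x.
rewrite /g/= patchE; case: ifPn; last first.
  rewrite notin_setE/= in_itv/= andbT => /negP; rewrite -ltNge => x1.
  rewrite mulr0 addr0 lee_fin normrM ler_piMl// ger0_norm ?exprn_ge0 ?(ltW x0)//.
  by rewrite exprn_ile1 ?(ltW x0) ?(ltW x1).
rewrite inE/= in_itv/= andbT => x1.
rewrite lee_fin ger0_norm; last by rewrite mulr_ge0// exprn_ge0// ltW.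
rewrite (le_trans _ (ler_norm _))//.
apply: (@le_trans _ _ (N * expR K * x ^- 2)); last first.
  by rewrite lerDr.
have -> : x ^+ k * f x = N * (expR (k.+1%:R * ln x - c * `|ln x - mu| `^ r)) * x ^- 2.
  rewrite gln_pdfE// expRD expRM_natl lnK// exprS.
  by field; rewrite gt_eqF.
by rewrite ler_wpM2r ?invr_ge0 ?sqr_ge0// ler_wpM2l// ler_expR.
Qed.

(** If [N] were 0, [f] would vanish identically and could not have mass 1. *)
Let N_gt0 : 0 < N.
Proof.
rewrite lt_neqAle N_ge0 andbT eq_sym; apply/eqP => N0.
move: int_f; rewrite integral0_eq => [/eqP|x _]; first by rewrite eqe eq_sym oner_eq0.
have [/gln_pdf0 ->//|x0] := leP x 0.
by rewrite gln_pdfE// N0 !mul0r.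
Qed.

Lemma integral_perturbed k eps :
  la.-integrable [set: R] (fun x => (x ^+ k * perturbed f p eps x)%:E) /\
  (\int[la]_x (x ^+ k * perturbed f p eps x)%:E =
   \int[la]_x (x ^+ k * f x)%:E)%E.
Proof.
have [ih h0] := integral_exprn_gln_h k.
have -> : (fun x => (x ^+ k * perturbed f p eps x)%:E) = (fun x =>
    (x ^+ k * f x)%:E + (eps / H)%:E * (x ^+ k * h x * f x)%:E)%E.
  apply/funext => x; rewrite -EFinM -EFinD /perturbed /gln_p; congr (_%:E); ring.
have if_ := integrable_exprn_gln_pdf k.
split; first by apply: integrableD => //; exact: integrableZl.
rewrite integralD//; last exact: integrableZl.
by rewrite integralZl// h0 mule0 adde0.
Qed.

Let perturbed_ge0 eps x : -1 <= eps <= 1 -> 0 <= perturbed f p eps x.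
Proof.
rewrite -ler_norml => eps1; rewrite mulr_ge0 ?gln_pdf_ge0//.
rewrite -lerBlDl sub0r lerNl (le_trans (ler_norm _))// normrN normrM.
by rewrite mulr_ile1// ler_norml gln_p_itv.
Qed.

Let measurable_perturbed eps : measurable_fun [set: R] (perturbed f p eps).
Proof.
apply: measurable_funM; first exact: measurable_gln_pdf.
apply: measurable_funD => //; apply: measurable_funM => //.
by rewrite gln_pE; apply: measurable_funM => //; exact: measurable_gln_h.
Qed.

Let integral_pos (g : R -> R) : (forall x, x <= 0 -> g x = 0) ->
  (\int[la]_(x in `]0%R, +oo[) (g x)%:E = \int[la]_x (g x)%:E)%E.
Proof.
move=> g0; rewrite integral_mkcond; apply: eq_integral => x _.
rewrite patchE; case: ifPn => //.
by rewrite notin_setE/= in_itv/= andbT => /negP; rewrite -leNgt => /g0 ->.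
Qed.

Lemma pdf_moment_perturbed k eps :
  pdf_moment (perturbed f p eps) k = pdf_moment f k.
Proof.
rewrite /pdf_moment !integral_pos ?(integral_perturbed k eps).2//.
- by move=> x /gln_pdf0 ->; rewrite mulr0.
- by move=> x /gln_pdf0 f0; rewrite /perturbed f0 mul0r mulr0.
Qed.

Let integral_perturbed1 eps : (\int[la]_x (perturbed f p eps x)%:E = 1)%E.
Proof.
have [_] := integral_perturbed 0 eps.
under eq_integral do rewrite mul1r; under [in X in _ = X]eq_integral do rewrite mul1r.
by rewrite int_f.
Qed.

Lemma is_pdf_pos_perturbed eps : -1 <= eps <= 1 -> is_pdf_pos (perturbed f p eps).
Proof.
move=> eps1; split.
- exact: measurable_perturbed.
- by move=> x _; exact: perturbed_ge0.
- by move=> x /gln_pdf0 f0; rewrite /perturbed f0 mul0r.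
- by rewrite integral_pos// => x /gln_pdf0 f0; rewrite /perturbed f0 mul0r.
Qed.

(** The integrand is positive on the interval, so a zero integral would make an interval of length 1
    negligible. This shows that [f] and [f (1 + p)] give it different probabilities. *)
Let integral_gln_p_neq0 :
  (\int[la]_(x in `]1%R, 2%R[) (f x * p x)%:E != 0)%E.
Proof.
have fp_gt0 x : x \in `]1, 2[ -> 0 < f x * p x.
  rewrite in_itv/= => x12; have x0 : 0 < x by lra.
  rewrite mulr_gt0 ?divr_gt0 ?gln_H_gt0 ?gln_h_gt0//.
  by rewrite gln_pdfE// mulr_gt0 ?expR_gt0// divr_gt0// N_gt0.
apply/eqP => fp0.
have : ae_eq la (`]1, 2[%classic : set R) (fun x => (f x * p x)%:E) (cst 0%E).
  apply/ae_eq_integral_abs => //.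
    apply/measurable_EFinP; apply: measurable_funTS; apply: measurable_funM.
      exact: measurable_gln_pdf.
    by rewrite gln_pE; apply: measurable_funM => //; exact: measurable_gln_h.
  rewrite -[RHS]fp0; apply: eq_integral => x; rewrite inE => x12.
  by rewrite gee0_abs// lee_fin ltW// fp_gt0.
move=> [B [mB B0 subB]]; have : (la `]1%R, 2%R[ <= la B)%E.
  apply: le_measure; rewrite ?inE// => x /= x12; apply: subB => /= fpx0.
  by have [] := fpx0 x12; apply/eqP; rewrite gt_eqF// fp_gt0.
rewrite B0 lebesgue_measure_itv/= lte_fin ltr1n -EFinB lee_fin.
lra.
Qed.

Context d (T : measurableType d) (P : probability T R) (X : {RV P >-> R}).
Hypothesis X_gln : has_density X f.

(** The factor [a] covers [h] with [a = 1] and [p] with [a = H^-1]. *)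
Lemma zero_weighted_moments_gln a :
  zero_weighted_moments X (fun x => a * h x).
Proof.
move=> k; have [ih h0] := integral_exprn_gln_h k.
pose g x := x ^+ k * (a * h x).
have gE : (fun x => (g x * f x)%:E) = (fun x => a%:E * (x ^+ k * h x * f x)%:E)%E.
  by apply/funext => x; rewrite -EFinM /g; congr (_%:E); ring.
have mg : measurable_fun [set: R] g.
  apply: measurable_funM; first exact: measurable_funX.
  by apply: measurable_funM => //; exact: measurable_gln_h.
have ig : la.-integrable [set: R] (fun x => (g x * f x)%:E).
  by rewrite gE; exact: integrableZl.
split; first exact: (integrable_comp_density gln_pdf_ge0 measurable_gln_pdf X_gln mg ig).
rewrite unlock (integral_comp_density gln_pdf_ge0 measurable_gln_pdf X_gln mg ig) gE.
by rewrite integralZl// h0 mule0.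
Qed.

Lemma gln_moment_indeterminate : moment_indeterminate (distribution P X).
Proof.
have mX k : measurable_fun [set: R] (fun x : R => x ^+ k) by exact: measurable_funX.
have one : -1 <= (1 : R) <= 1 by lra.
pose p_ge0 x := @perturbed_ge0 1 x one; pose mp := measurable_perturbed 1.
(* [Q] is the law with density [f (1 + p)]. The identity [Y] carries it from the display of the
   Lebesgue measure to that of [R]. *)
have [Q QE] := @exists_density_probability _ (measurableTypeR R) R la _ p_ge0
  mp (integral_perturbed1 1).
have mid : measurable_fun [set: measurableTypeR R] (id : measurableTypeR R -> R) by [].
pose Y : {RV Q >-> R} := @mfun_Sub _ _ (measurableTypeR R) R _ (mem_set mid).
have Yp : has_density Y (perturbed f p 1) by move=> A mA; rewrite -QE.
split.
  move=> k.
  apply: (integrable_distribution_density gln_pdf_ge0 measurable_gln_pdf X_gln) => //.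
  exact: integrable_exprn_gln_pdf.
exists (distribution Q Y); split.
- move=> k; apply: (integrable_distribution_density p_ge0 mp Yp) => //.
  exact: (integral_perturbed k 1).1.
- move=> k; rewrite (integral_distribution_density p_ge0 mp Yp)//; last first.
    exact: (integral_perturbed k 1).1.
  rewrite (integral_distribution_density gln_pdf_ge0 measurable_gln_pdf X_gln)//.
    exact: (integral_perturbed k 1).2.
  exact: integrable_exprn_gln_pdf.
- have mA : measurable (`]1, 2[%classic : set R) by [].
  exists `]1%R, 2%R[%classic => // QA.
  have ifA : la.-integrable `]1, 2[ (fun x => (f x)%:E).
    by apply: (integrableS measurableT) => //; exact: integrable_f.
  have ifp : la.-integrable `]1, 2[ (fun x => (f x * p x)%:E).
    apply: (integrableS measurableT) => //.
    have -> : (fun x => (f x * p x)%:E) =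
        (fun x => H^-1%:E * (x ^+ 0 * h x * f x)%:E)%E.
      by apply/funext => x; rewrite -EFinM gln_pE; congr (_%:E); ring.
    by apply: integrableZl => //; exact: (integral_exprn_gln_h 0).1.
  (* Equal probabilities of []1, 2[] would give equal integrals of [f + f p] and [f]; the integral
     of [f] is finite, so it cancels and that of [f p] would be 0. *)
  have := etrans (esym (Yp _ mA)) (etrans QA (X_gln mA)).
  have -> : (\int[la]_(x in `]1%R, 2%R[) (perturbed f p 1 x)%:E =
      \int[la]_(x in `]1%R, 2%R[) (f x)%:E +
      \int[la]_(x in `]1%R, 2%R[) (f x * p x)%:E)%E.
    rewrite -integralD//; apply: eq_integral => x _.
    by rewrite /perturbed mul1r mulrDr mulr1 EFinD.
  have fin_f : (\int[la]_(x in `]1%R, 2%R[) (f x)%:E)%E \is a fin_num.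
    exact: integrable_fin_num.
  move=> /(congr1 (fun z => z - \int[la]_(x in `]1%R, 2%R[) (f x)%:E)%E).
  rewrite subee// [X in (X - _)%E]addeC addeK// => fp0.
  by move: integral_gln_p_neq0; rewrite fp0 eqxx.
Qed.

End finite_mass.
End gln.

Theorem theorem4 (R : realType) (mu sigma r : R)
    (sigma_gt0 : 0 < sigma) (r_gt1 : 1 < r)
    (d : measure_display) (T : measurableType d) (P : probability T R)
    (X : {RV P >-> R}) (X_gln : has_density X (gln_pdf mu sigma r)) :
  [/\
      [bounded gln_h mu sigma r x | x in `]0, +oo[%classic] /\
      zero_weighted_moments X (gln_h mu sigma r),
      is_perturbation X (gln_p mu sigma r) &
      is_stieltjes_class X (gln_pdf mu sigma r) (gln_p mu sigma r)
        [set perturbed (gln_pdf mu sigma r) (gln_p mu sigma r) eps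
           | eps in `[-1, 1]] /\
      forall eps : R, -1 <= eps <= 1 ->
        is_pdf_pos (perturbed (gln_pdf mu sigma r) (gln_p mu sigma r) eps) /\
        forall k : nat,
          pdf_moment (perturbed (gln_pdf mu sigma r) (gln_p mu sigma r) eps) k =
          pdf_moment (gln_pdf mu sigma r) k].
Proof.
(* Total mass 1 is read off the law of [X] on the whole line, with no evaluation of the [Gamma]
   integral. *)
have int_f : (\int[lebesgue_measure]_x (gln_pdf mu sigma r x)%:E = 1)%E.
  by rewrite -(X_gln setT)// probability_setT.
have hE : gln_h mu sigma r = fun x => 1 * gln_h mu sigma r x.
  by apply/funext => x; rewrite mul1r.
have pP : is_perturbation X (gln_p mu sigma r).
  split; first exact: gln_p_itv.
  by rewrite gln_pE; exact: zero_weighted_moments_gln.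
split => //; split.
- have [M MP] := gln_h_bounded mu sigma_gt0 r_gt1.
  (* Boundedness is a statement near [+oo]: every [K] above some real [M] has to be a bound. *)
  exists M; split; first exact: num_real.
  by move=> K MK x _; rewrite /= (le_trans (MP x))// ltW.
- rewrite hE; exact: zero_weighted_moments_gln.
- by split => //; exact: (gln_moment_indeterminate sigma_gt0 r_gt1 int_f X_gln).
- move=> eps eps1; split; first exact: is_pdf_pos_perturbed.
  by move=> k; exact: pdf_moment_perturbed.
Qed.
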